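(* Let $\rho=\rho_1\circ\cdots\circ\rho_n$ with $\rho_i\in\mathcal G_i$, and let $\Gamma_u$ be a permutation-$\rho$-invariant game. Suppose $a^*=(a_i^* )_{i\in[n]}$ is a pure Nash equilibrium of $\Gamma_u$ and there is at least one player $k\in[n]$ with $a_k^*\in V(\rho_k)$. Then $a^*$ is never found by any NE approximator that is both PPE and OPI; that is, for every such approximator $f$, $f(u)$ is not the pure product strategy $a^*$. Moreover, $a^*$ (as a pure CE or CCE) is never found by any CE or CCE approximator that is PE; that is, for every such approximator $f$, $f(u)$ is not the point mass at $a^*$.
   Context: Fix a number of players $n\ge2$ and finite action sets $\mathcal A_i=\{1,\dots,m_i\}$, $i\in[n]$; $\mathcal A=\prod_i\mathcal A_i$. A payoff is $u=(u_i)_{i\in[n]}$ with $u_i:\mathcal A\to[0,1]$; $\mathcal U$ is the set of all payoffs, and $\Gamma_u=(n,\mathcal A,u)$ is the normal-form game with payoff $u$. An NE approximator is a map $f:\mathcal U\to\prod_i\Delta\mathcal A_i$, with $f(u)_i$ player $i$'s strategy; a CE or CCE approximator is a map $f:\mathcal U\to\Delta\mathcal A$. Permutations: $\mathcal G_i$ is the group of all bijections $\rho_i:\mathcal A_i\to\mathcal A_i$. $\rho_iu$ is the payoff with $(\rho_iu)_j(a_i,a_{-i})=u_j(\rho_i^{-1}(a_i),a_{-i})$ for all $j$; for $\pi\in\Delta\mathcal A$, $(\rho_i\pi)(a_i,a_{-i})=\pi(\rho_i^{-1}(a_i),a_{-i})$; for $\sigma_i\in\Delta\mathcal A_i$, $(\rho_i\sigma_i)(a_i)=\sigma_i(\rho_i^{-1}(a_i))$.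 The composition $\rho=\rho_1\circ\cdots\circ\rho_n$ acts by applying all $\rho_i$. $\Gamma_u$ is permutation-$\rho$-invariant if $\rho u=u$. $V(\rho_k)=\{a_k\in\mathcal A_k:\rho_k(a_k)\ne a_k\}$. An NE approximator $f$ is PPE if $f(\rho_iu)_i=\rho_if(u)_i$ for all $i$, $\rho_i\in\mathcal G_i$, $u\in\mathcal U$; it is OPI if $f(\rho_iu)_j=f(u)_j$ for all $i$, $\rho_i\in\mathcal G_i$, $j\neq i$, $u\in\mathcal U$. A CE or CCE approximator $f$ is PE if $f(\rho_iu)=\rho_if(u)$ for all $i$, $\rho_i\in\mathcal G_i$, $u\in\mathcal U$. *)

(* Defs.v *)
From HB Require Import structures.
From mathcomp Require Import all_boot all_order all_algebra all_fingroup.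
From mathcomp Require Import reals.

Set Implicit Arguments.
Unset Strict Implicit.
Unset Printing Implicit Defensive.

Import Order.TTheory GRing.Theory Num.Theory.
Local Open Scope ring_scope.

Section Simplex.
Variables (R : realType) (T : finType).

Definition is_distr (p : {ffun T -> R}) : bool :=
  [forall x, 0 <= p x] && (\sum_x p x == 1).

Record simplex : Type := Simplex { prob :> {ffun T -> R}; _ : is_distr prob }.

HB.instance Definition _ := [isSub for prob].
HB.instance Definition _ := [Choice of simplex by <:].

Lemma is_distr_dirac (x : T) : is_distr [ffun y => (y == x)%:R].
Proof.
apply/andP; split; first by apply/forallP => y; rewrite ffunE ler0n.
rewrite (bigD1 x) //= ffunE eqxx big1 ?addr0 // => y /negPf ynx.
by rewrite ffunE ynx.
Qed.

Definition dirac (x : T) : simplex := Simplex (is_distr_dirac x).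

Lemma is_distr_comp (g : T -> T) (p : simplex) :
  injective g -> is_distr [ffun x => p (g x)].
Proof.
case: p => p /= /andP[/forallP p_ge0 /eqP p_sum] g_inj.
apply/andP; split; first by apply/forallP => x; rewrite ffunE p_ge0.
rewrite -p_sum [X in _ == X](reindex_inj g_inj) /=.
by apply/eqP/eq_bigr => x _; rewrite ffunE.
Qed.

End Simplex.

Section Game.
Variables (R : realType) (n : nat) (m : 'I_n -> nat).

(* Players and actions are numbered from 0. *)
Definition profile : Type := {dffun forall i : 'I_n, 'I_(m i)}.

HB.instance Definition _ := Finite.on profile.

(* (b, a_{-i}) *)
Definition deviate (i : 'I_n) (a : profile) (b : 'I_(m i)) : profile :=
  [ffun j => dfwith a b j].

Definition is_payoff (u : {ffun 'I_n -> {ffun profile -> R}}) : bool :=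
  [forall j, forall a, 0 <= u j a <= 1].

Record payoff : Type := Payoff {
  payoff_val :> {ffun 'I_n -> {ffun profile -> R}};
  _ : is_payoff payoff_val }.

HB.instance Definition _ := [isSub for payoff_val].
HB.instance Definition _ := [Choice of payoff by <:].

Definition pure_nash (u : payoff) (a : profile) : Prop :=
  forall (i : 'I_n) (b : 'I_(m i)), u i (deviate a b) <= u i a.

(* (rho_i^{-1}(a_i), a_{-i}) *)
Definition unpermute (i : 'I_n) (r : 'S_(m i)) (a : profile) : profile :=
  deviate a ((r^-1)%g (a i)).

Lemma unpermute_inj (i : 'I_n) (r : 'S_(m i)) : injective (unpermute r).
Proof.
move=> a b /ffunP eq_ab; apply/ffunP => j; have := eq_ab j; rewrite !ffunE.
have [<-|nij] := eqVneq i j; first by rewrite !dfwith_in => /perm_inj.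
by rewrite !dfwith_out.
Qed.

Lemma is_payoff_perm (i : 'I_n) (r : 'S_(m i)) (u : payoff) :
  is_payoff [ffun j => [ffun a => u j (unpermute r a)]].
Proof.
case: u => u /= /forallP u01; apply/forallP => j; apply/forallP => a.
by rewrite !ffunE; exact: (forallP (u01 j)).
Qed.

Definition perm_payoff (i : 'I_n) (r : 'S_(m i)) (u : payoff) : payoff :=
  Payoff (is_payoff_perm r u).

Definition perm_joint (i : 'I_n) (r : 'S_(m i)) (p : simplex R profile) :
    simplex R profile :=
  Simplex (is_distr_comp p (@unpermute_inj i r)).

Definition perm_strategy (i : 'I_n) (r : 'S_(m i)) (s : simplex R 'I_(m i)) :
    simplex R 'I_(m i) :=
  Simplex (is_distr_comp s (@perm_inj _ (r^-1)%g)).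

(* rho_1 (rho_2 (... (rho_n u))) *)
Definition perm_all_payoff (rho : forall i, 'S_(m i)) (u : payoff) : payoff :=
  foldr (fun i v => perm_payoff (rho i) v) u (enum 'I_n).

Definition perm_invariant (rho : forall i, 'S_(m i)) (u : payoff) : Prop :=
  perm_all_payoff rho u = u.

Definition moved (i : 'I_n) (r : 'S_(m i)) : {set 'I_(m i)} :=
  [set b | r b != b].

Definition mixed_profile : Type :=
  {dffun forall i : 'I_n, simplex R 'I_(m i)}.

Definition pure_profile (a : profile) : mixed_profile :=
  [ffun i => dirac R (a i)].

Definition NE_approximator : Type := payoff -> mixed_profile.

(* The type of CE approximators as well as of CCE approximators. *)
Definition CE_approximator : Type := payoff -> simplex R profile.

Definition PPE (f : NE_approximator) : Prop :=
  forall (i : 'I_n) (r : 'S_(m i)) (u : payoff),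
    f (perm_payoff r u) i = perm_strategy r (f u i).

Definition OPI (f : NE_approximator) : Prop :=
  forall (i : 'I_n) (r : 'S_(m i)) (j : 'I_n) (u : payoff),
    j != i -> f (perm_payoff r u) j = f u j.

Definition PE (f : CE_approximator) : Prop :=
  forall (i : 'I_n) (r : 'S_(m i)) (u : payoff),
    f (perm_payoff r u) = perm_joint r (f u).

End Game.

(* Main.v *)
Require Import Defs.
From mathcomp Require Import all_boot all_order all_algebra all_fingroup.
From mathcomp Require Import reals.

(** Equivariance turns the invariance of u under rho into a fixed-point
    property of the output: the strategy of player k (for NE approximators) or
    the joint distribution (for CE and CCE approximators) is fixed by rho.
    Permuting a point mass moves its atom, and the k-th coordinate of a is
    moved by rho_k, so the point mass at a is not fixed. *)

Import GRing.Theory.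
Local Open Scope ring_scope.

Lemma dirac_inj (R : realType) (T : finType) : injective (@dirac R T).
Proof.
move=> x y /(congr1 (fun p : simplex R T => p x)); rewrite /= !ffunE eqxx.
by have [//|_ /eqP] := eqVneq x y; rewrite oner_eq0.
Qed.

Section Permutation.
Variables (R : realType) (n : nat) (m : 'I_n -> nat).
Implicit Types (u : payoff R m) (a : profile m).

Lemma unpermuteE (i : 'I_n) (r : 'S_(m i)) a :
  unpermute r a i = (r^-1)%g (a i).
Proof. by rewrite ffunE dfwith_in. Qed.

Lemma unpermute_out (i j : 'I_n) (r : 'S_(m i)) a :
  i != j -> unpermute r a j = a j.
Proof. by move=> nij; rewrite ffunE dfwith_out. Qed.

Lemma unpermuteK (i : 'I_n) (r : 'S_(m i)) :
  cancel (@unpermute n m i r) (unpermute (r^-1)%g).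
Proof.
move=> a; apply/ffunP => j; have [<-|nij] := eqVneq i j.
  by rewrite !unpermuteE permK.
by rewrite !unpermute_out.
Qed.

Lemma unpermuteVK (i : 'I_n) (r : 'S_(m i)) :
  cancel (@unpermute n m i (r^-1)%g) (unpermute r).
Proof. by move=> a; have := unpermuteK i (r^-1)%g a; rewrite invgK. Qed.

Lemma perm_strategy_dirac (i : 'I_n) (r : 'S_(m i)) (x : 'I_(m i)) :
  perm_strategy r (dirac R x) = dirac R (r x).
Proof.
apply/val_inj/ffunP => y; rewrite /= !ffunE.
by rewrite (can2_eq (permKV r) (permK r)).
Qed.

(** The action on distributions precomposes with [unpermute r], so an atom moves by its inverse map,
    which is [unpermute] of [r^-1]. *)
Lemma perm_joint_dirac (i : 'I_n) (r : 'S_(m i)) a :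
  perm_joint r (dirac R a) = dirac R (unpermute (r^-1)%g a).
Proof.
apply/val_inj/ffunP => b; rewrite /= !ffunE.
by rewrite (can2_eq (unpermuteK i r) (unpermuteVK i r)).
Qed.

(** Each factor touches only its own coordinate, and [uniq s] ensures that coordinate [k] is hit at
    most once. *)
Lemma foldr_unpermuteV (rho : forall i, 'S_(m i)) a (s : seq 'I_n) (k : 'I_n) :
  uniq s ->
  foldr (fun i => unpermute ((rho i)^-1)%g) a s k
  = if k \in s then rho k (a k) else a k.
Proof.
elim: s => //= i s IHs /andP[i_s /IHs {}IHs]; rewrite inE.
have [ki|nki] := eqVneq k i; last by rewrite unpermute_out // eq_sym.
by move: i_s IHs; rewrite -ki unpermuteE invgK => /negPf -> ->.
Qed.

(** Peeling off the head [i] uses PPE when [i] is [k] and OPI otherwise; by uniqueness, [k] does not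
    recur in the tail. *)
Lemma PPE_OPI_foldr (f : NE_approximator R m) (rho : forall i, 'S_(m i)) u
    (s : seq 'I_n) (k : 'I_n) :
  PPE f -> OPI f -> uniq s ->
  f (foldr (fun i => perm_payoff (rho i)) u s) k
  = if k \in s then perm_strategy (rho k) (f u k) else f u k.
Proof.
move=> ppe opi; elim: s => //= i s IHs /andP[i_s /IHs {}IHs]; rewrite inE.
have [ki|nki] := eqVneq k i; last by rewrite opi.
by move: i_s IHs; rewrite -ki ppe => /negPf -> ->.
Qed.

(** A permuted point mass is again a point mass, so the action on outputs reduces to tracking one
    profile. *)
Lemma PE_foldr_dirac (f : CE_approximator R m) (rho : forall i, 'S_(m i)) u a
    (s : seq 'I_n) :
  PE f -> f u = dirac R a ->
  f (foldr (fun i => perm_payoff (rho i)) u s)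
  = dirac R (foldr (fun i => unpermute ((rho i)^-1)%g) a s).
Proof. by move=> pe fu; elim: s => //= i s IHs; rewrite pe IHs perm_joint_dirac. Qed.

End Permutation.

Theorem theorem5p3 (R : realType) (n : nat) (m : 'I_n -> nat)
    (hn : (2 <= n)%N) (rho : forall i : 'I_n, 'S_(m i))
    (u : payoff R m) (a : profile m)
    (hinv : perm_invariant rho u) (hnash : pure_nash u a)
    (hmoved : exists k : 'I_n, a k \in moved (rho k)) :
  (forall f : NE_approximator R m,
     PPE f -> OPI f -> f u <> pure_profile R a) /\
  (forall f : CE_approximator R m,
     PE f -> f u <> dirac R a).
Proof.
case: hmoved => k; rewrite inE => /eqP rak; split=> f.
  move=> ppe opi fu; apply: rak.
  have := PPE_OPI_foldr R n m f rho u (enum 'I_n) k ppe opi (enum_uniq _).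
  (* Over all players the fold is [perm_all_payoff rho u], which is [u] by invariance; hence [rho k]
     fixes the point mass at [a k]. *)
  rewrite -/(perm_all_payoff rho u) hinv mem_enum fu ffunE.
  by rewrite perm_strategy_dirac => /dirac_inj.
move=> pe fu; apply: rak.
have := PE_foldr_dirac R n m f rho u a (enum 'I_n) pe fu.
rewrite -/(perm_all_payoff rho u) hinv fu => /dirac_inj a_fix.
(* Only the right-hand [a] is expanded by [a_fix]; its coordinate [k] then reads [rho k (a k)]. *)
by rewrite [in RHS]a_fix foldr_unpermuteV ?enum_uniq // mem_enum.
Qed.
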